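(* Let $\phi\colon X\to Y$ and $\psi\colon Y\to Z$ be factor maps between weakly mean equicontinuous actions of a countable amenable group $G$ on compact metrizable spaces. If $\phi$ is topo-isomorphic and $\psi$ is mean equicontinuous, then $\pi:=\psi\circ\phi\colon X\to Z$ is mean equicontinuous.
   Context: $G$ is a countable (discrete) amenable group; a Følner sequence is a sequence $(F_n)$ of nonempty finite subsets of $G$ with $|F_n\Delta gF_n|/|F_n|\to 0$ for all $g\in G$. An action $X$ of $G$ is a compact metrizable space $X$ with a homomorphism from $G$ to the homeomorphisms of $X$, written $(g,x)\mapsto g.x$. An action $X$ is weakly mean equicontinuous if for each $x\in X$ there is a unique $G$-invariant Borel probability measure $\mu_x$ on the orbit closure $\overline{G.x}$, and the map $x\mapsto\mu_x$ is continuous for the weak*-topology. $d$ denotes a metric inducing the topology (the notions below do not depend on its choice). A factor map $\pi\colon X\to Y$ is a continuous surjection with $\pi(g.x)=g.\pi(x)$ for all $g\in G$, $x\in X$, and $R(\pi):=\{(x,x')\in X^2;\ \pi(x)=\pi(x')\}$. The Weyl pseudometric is $D(x,x'):=\sup_{(F_n)}\limsup_{n\to\infty}\frac1{|F_n|}\sum_{g\in F_n}d(g.x,g.x')$, the supremum being over all Følner sequences. A pair $(x,x')$ is Banach proximal if $D(x,x')=0$; a sequence $(x_n,x_n')$ in $X^2$ is asymptotically Banach proximal if $D(x_n,x_n')\to0$. A factor map $\pi$ is mean equicontinuous if for every convergent sequence in $R(\pi)$ the sequence is asymptotically Banach proximal if and only if its limit is Banach proximal. A factor map $\phi\colon X\to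 Y$ is topo-isomorphic if for every $G$-invariant Borel probability measure $\mu$ on $X$ there is a Borel set $M\subseteq Y$ with $\phi_*\mu(M)=\mu(\phi^{-1}(M))=1$ such that $\phi$ restricts to a bi-measurable bijection $\phi^{-1}(M)\to M$. *)

(* Defs.v *)
From HB Require Import structures.
From mathcomp Require Import all_boot all_order all_algebra finmap.
From mathcomp Require Import all_classical all_reals all_analysis.

Set Implicit Arguments.
Unset Strict Implicit.
Unset Printing Implicit Defensive.

Import Order.TTheory GRing.Theory Num.Theory.
Import numFieldNormedType.Exports.

Local Open Scope classical_set_scope.
Local Open Scope ring_scope.

Definition is_folner (R : realType) (G : groupType) (F : nat -> {fset G}) : Prop :=
  (forall n, F n != fset0) /\
  forall g : G,
    (fun n => let gF := [fset (g * h)%g | h in F n]%fset in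
      #|` ((F n `\` gF) `|` (gF `\` F n))%fset |%:R / #|` F n |%:R : R)
    @ \oo --> (0 : R).

(* The usual definition by Folner sequences, for countable discrete groups only. *)
Definition amenable (R : realType) (G : groupType) : Prop :=
  exists F : nat -> {fset G}, is_folner R F.

(* Each [act g] is a homeomorphism, with inverse [act g^-1]. *)
Record action (G : groupType) (X : topologicalType) := Action {
  act :> G -> X -> X;
  act1 : forall x, act 1%g x = x;
  actM : forall g h x, act (g * h)%g x = act g (act h x);
  act_continuous : forall g, continuous (act g) }.

(* [measurableType]s are pointed: the Borel sigma-algebra of [X] is put on the
   alias [borel x0] of [X], where [x0] plays no other role. Quantifying over
   [x0 : X] in the definitions below keeps the empty space in scope. *)
Definition pointed_at (X : Type) (x0 : X) : Type := X.
HB.instance Definition _ (X : topologicalType) (x0 : X) :=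
  Topological.copy (pointed_at x0) X.
HB.instance Definition _ (X : topologicalType) (x0 : X) :=
  isPointed.Build (pointed_at x0) x0.

Definition borel (X : topologicalType) (x0 : X) :=
  g_sigma_algebraType (@open (pointed_at x0)).

(* The coarsest topology making mu |-> \int f dmu continuous for every
   continuous f : X -> R. *)
Definition weak_star (R : realType) (X : topologicalType) (x0 : X) :=
  initial_topology
    (fun mu : probability (borel x0) R =>
       (fun f : continuousType X R => \int[mu]_x f x)
       : {ptws continuousType X R -> R}).

Definition invariant_measure (R : realType) (G : groupType)
    (X : topologicalType) (a : action G X) (x0 : X)
    (mu : probability (borel x0) R) : Prop :=
  forall (g : G) (A : set (borel x0)), measurable A ->
    pushforward mu (a g : borel x0 -> borel x0) A = mu A.

Definition orbit_closure (G : groupType) (X : topologicalType)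
    (a : action G X) (x : X) : set X := closure (range (fun g => a g x)).

(* A measure on the closed set C is a measure on X giving full mass to C. *)
Definition invariant_measure_on (R : realType) (G : groupType)
    (X : topologicalType) (a : action G X) (C : set X) (x0 : X)
    (mu : probability (borel x0) R) : Prop :=
  invariant_measure a mu /\ mu C = 1%E.

(* Library measures are functions on all sets, constrained only on measurable
   ones; hence uniqueness is stated on measurable sets. *)
Definition weakly_mean_equicontinuous (R : realType) (G : groupType)
    (X : topologicalType) (a : action G X) : Prop :=
  forall x0 : X, exists mu : X -> probability (borel x0) R,
    (forall x, invariant_measure_on a (orbit_closure a x) (mu x) /\
       forall nu : probability (borel x0) R,
         invariant_measure_on a (orbit_closure a x) nu ->
         forall A : set (borel x0), measurable A -> nu A = mu x A) /\
    continuous (mu : X -> weak_star R x0).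

Definition weyl (R : realType) (G : groupType) (X : metricType R)
    (a : action G X) (x x' : X) : \bar R :=
  ereal_sup [set limn_esup (fun n =>
      ((\sum_(g <- F n) mdist (a g x) (a g x')) / #|` F n |%:R)%:E)
    | F in is_folner R (G := G)].

Definition banach_proximal (R : realType) (G : groupType) (X : metricType R)
    (a : action G X) (x x' : X) : Prop := weyl a x x' = 0%E.

Definition asymptotically_banach_proximal (R : realType) (G : groupType)
    (X : metricType R) (a : action G X) (u : nat -> X * X) : Prop :=
  (fun n => weyl a (u n).1 (u n).2) @ \oo --> 0%E.

Definition factor_map (G : groupType) (X Y : topologicalType)
    (aX : action G X) (aY : action G Y) (pi : X -> Y) : Prop :=
  [/\ continuous pi, range pi = [set: Y]
    & forall g x, pi (aX g x) = aY g (pi x)].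

Definition fiber_rel (X Y : Type) (pi : X -> Y) : set (X * X) :=
  [set p | pi p.1 = pi p.2].

Definition mean_equicontinuous (R : realType) (G : groupType)
    (X : metricType R) (Y : Type) (a : action G X) (pi : X -> Y) : Prop :=
  forall (u : nat -> X * X) (p : X * X),
    (forall n, fiber_rel pi (u n)) -> fiber_rel pi p -> u @ \oo --> p ->
    asymptotically_banach_proximal a u <-> banach_proximal a p.1 p.2.

(* As M and phi^-1(M) are Borel, the Borel sets of these subspaces are the Borel
   sets contained in them; the last clause is measurability of the inverse. *)
Definition topo_isomorphic (R : realType) (G : groupType)
    (X Y : topologicalType) (a : action G X) (phi : X -> Y) : Prop :=
  forall (x0 : X) (mu : probability (borel x0) R), invariant_measure a mu ->
  let phi' : borel x0 -> borel (phi x0) := phi in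
  exists M : set (borel (phi x0)),
    [/\ measurable M, pushforward mu phi' M = 1%E /\ mu (phi' @^-1` M) = 1%E,
        set_bij (phi' @^-1` M) M phi',
        measurable_fun (phi' @^-1` M) phi'
      & forall A : set (borel x0), measurable A -> A `<=` phi' @^-1` M ->
          measurable (phi' @` A)].

(* Main.v *)
Require Import Defs.
From HB Require Import structures.
From mathcomp Require Import all_boot all_order all_algebra finmap.
From mathcomp Require Import all_classical all_reals all_analysis.
From mathcomp Require Import ring lra.

(** A topo-isomorphic factor map phi : X -> Y makes the Weyl pseudometrics of
    X and Y uniformly equivalent: for every e > 0 there is d > 0 such that
    D(phi x, phi x') < d implies D(x, x') <= e, and conversely. Hence a pair of
    X is Banach proximal exactly when its image in Y is, a sequence of pairs of
    X is asymptotically Banach proximal exactly when its image is, and mean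
    equicontinuity of psi transfers to psi \o phi by pushing convergent
    sequences of pairs forward along phi.

    Both implications are instances of [determines_weyl]. Given equivariant
    continuous f : X -> P and h : X -> Q such that, up to a null set of any
    invariant measure, h p = h q forces f p = f q, closeness of h x and h x'
    for the Weyl pseudometric of Q forces closeness of f x and f x' for that
    of P. One implication is f = id, h = phi, where the full measure set is
    phi^-1(M) with M given by topo-isomorphy; the other is f = phi, h = id.

    For [determines_weyl], suppose that x_n, x'_n have D(h x_n, h x'_n) -> 0
    but D(f x_n, f x'_n) > e. A limit of Folner averages along an ultrafilter
    is an invariant mean L_n on the bounded functions on G ([folner_mean]) and
    can be chosen so that the mean of d(g f x_n, g f x'_n) is at least e while
    that of d(g h x_n, g h x'_n) tends to 0 ([weyl_mean]). Evaluating L_n on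
    visits of the orbits of x_n and x'_n to a set A, and passing to a limit
    over n, gives an invariant finitely additive probability m on all subsets
    of X. As X is compact, m has a regularization mu, a genuine invariant Borel
    probability ([invariant_regular_probability]), so there is a Borel set B
    with mu B = 1 on which h determines f. By construction of mu, the
    complement of B is contained in an open set U all of whose closed subsets
    have small m-mass. On the closed set K = ~` U, h determines f, so by
    compactness there are an open V containing K and d > 0 such that points of
    V with d-close images under h have close images under f
    ([factor_modulus]). The orbits of x_n and x'_n spend little time in ~` V,
    and outside of that time the distance of the images under f is small
    unless that of the images under h is at least d; so the L_n-mean of the
    former is less than e for some n, a contradiction. *)

Set Implicit Arguments.
Unset Strict Implicit.
Unset Printing Implicit Defensive.
Import Order.TTheory GRing.Theory Num.Theory.
Import numFieldNormedType.Exports.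
Local Open Scope classical_set_scope.
Local Open Scope ring_scope.

(** * Bounded functions and limits along ultrafilters *)

Section bounded.
Context {I : Type} {R : realType}.
Implicit Types f h : I -> R.

Definition bdd f := exists C, forall i, `|f i| <= C.

Lemma bdd_cst c : bdd (fun=> c). Proof. by exists `|c|. Qed.

Lemma bddD f h : bdd f -> bdd h -> bdd (fun i => f i + h i).
Proof.
move=> [C fC] [D hD]; exists (C + D) => i.
by rewrite (le_trans (ler_normD _ _))// lerD.
Qed.

Lemma bddZ c f : bdd f -> bdd (fun i => c * f i).
Proof. by move=> [C fC]; exists (`|c| * C) => i; rewrite normrM ler_wpM2l. Qed.

Lemma bdd_itv a b f : (forall i, a <= f i <= b) -> bdd f.
Proof.
move=> fab; exists (`|a| + `|b|) => i; have /andP[af fb] := fab i.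
rewrite ler_norml; apply/andP; split.
- have := ler_norm (- a); rewrite normrN; have := normr_ge0 b; lra.
- have := ler_norm b; have := normr_ge0 a; lra.
Qed.

End bounded.

Section ultralimits.
Context (W : set_system nat) {UW : UltraFilter W}.

Lemma ultra_compact_cvg (T : topologicalType) (K : set T) (u : nat -> T) :
  compact K -> (forall i, K (u i)) -> exists2 l, K l & u @ W --> l.
Proof.
move=> cK Ku.
have uK : (u @ W) K by apply: (@filterE _ W _ (u @^-1` K)) => i; exact: Ku.
have [l [Kl cl]] := cK (u @ W) (fmap_proper_filter u ultra_proper) uK.
exists l => // B nB.
have [//|WB] := in_ultra_setVsetC (u @^-1` B) UW.
by have [y [? ?]] := cl (~` B) B WB nB.
Qed.

Context {R : realType}.
Implicit Types u v : nat -> R.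

Lemma ultra_lim_cvg u : bdd u -> u @ W --> lim (u @ W).
Proof.
move=> [C uC].
have [|l _ ul] := @ultra_compact_cvg R `[- C, C]%classic u (@segment_compact _ _ _).
  by move=> i /=; rewrite in_itv/= -ler_norml.
by apply/cvg_ex; exists l.
Qed.

Lemma ultra_limD u v : bdd u -> bdd v ->
  lim ((fun i => u i + v i) @ W) = lim (u @ W) + lim (v @ W).
Proof.
move=> /ultra_lim_cvg cu /ultra_lim_cvg cv.
by apply/cvg_lim => //; exact: cvgD.
Qed.

Lemma ultra_limZ c u : bdd u -> lim ((fun i => c * u i) @ W) = c * lim (u @ W).
Proof.
by move=> /ultra_lim_cvg cu; apply/cvg_lim => //; apply: cvgM => //; exact: cvg_cst.
Qed.

Lemma ultra_lim_cst (c : R) : lim ((fun=> c) @ W) = c.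
Proof. by apply/cvg_lim => //; exact: cvg_cst. Qed.

Lemma ultra_lim_le u v : bdd u -> bdd v -> (\forall i \near W, u i <= v i) ->
  lim (u @ W) <= lim (v @ W).
Proof.
by move=> /ultra_lim_cvg cu /ultra_lim_cvg cv; exact: ler_cvg_to.
Qed.

End ultralimits.

(** * Folner averages and invariant means *)

Section folner_averages.
Context {R : realType} {G : groupType}.
Local Open Scope fset_scope.
Local Open Scope ring_scope.

Definition avg (A : {fset G}) (f : G -> R) : R :=
  (\sum_(g <- A) f g) / #|` A|%:R.

Lemma avg_le A f h : (forall g, f g <= h g) -> avg A f <= avg A h.
Proof. by move=> fh; rewrite ler_wpM2r ?invr_ge0// ler_sum. Qed.

Lemma avgD A f h : avg A (fun g => f g + h g) = avg A f + avg A h.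
Proof. by rewrite /avg big_split/= mulrDl. Qed.

Lemma avgZ A c f : avg A (fun g => c * f g) = c * avg A f.
Proof. by rewrite /avg -mulr_sumr mulrA. Qed.

Lemma avg_cst A c : A != fset0 -> avg A (fun=> c) = c.
Proof.
move=> A0; rewrite /avg big_const_seq count_predT iter_addr_0.
by rewrite -(mulr_natr c) mulfK// pnatr_eq0 cardfs_eq0.
Qed.

Lemma avg_norm_le A f C : A != fset0 -> (forall g, `|f g| <= C) -> `|avg A f| <= C.
Proof.
move=> A0 fC; rewrite ler_norml; apply/andP; split.
- rewrite -(avg_cst (- C) A0) avg_le// => g.
  by have := fC g; rewrite ler_norml => /andP[].
- rewrite -[leRHS](avg_cst C A0) avg_le// => g.
  by have := fC g; rewrite ler_norml => /andP[].
Qed.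

(** The two sums share the terms over the intersection, so only the symmetric
    difference contributes. *)
Lemma sum_fsetB_le (A B : {fset G}) (f : G -> R) C : (forall g, `|f g| <= C) ->
  `|\sum_(g <- A) f g - \sum_(g <- B) f g|
    <= C * #|` (A `\` B) `|` (B `\` A)|%:R.
Proof.
move=> fC.
have sC (D : {fset G}) : `|\sum_(g <- D) f g| <= C * #|` D|%:R.
  rewrite (le_trans (ler_norm_sum _ _ _))// (le_trans (ler_sum _ (fun g _ => fC g)))//.
  by rewrite big_const_seq count_predT iter_addr_0 mulr_natr.
rewrite (big_fsetID _ (mem B) A) (big_fsetID _ (mem A) B)/=.
rewrite (_ : [fset x in A | x \in B] = [fset x in B | x \in A]); last first.
  by apply/fsetP => x; rewrite !inE andbC.
rewrite opprD addrACA subrr add0r.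
rewrite (_ : [fset x in A | x \notin B] = A `\` B); last first.
  by apply/fsetP => x; rewrite !inE andbC.
rewrite (_ : [fset x in B | x \notin A] = B `\` A); last first.
  by apply/fsetP => x; rewrite !inE andbC.
rewrite (le_trans (ler_normB _ _))// (le_trans (lerD (sC _) (sC _)))//.
rewrite -mulrDr -natrD -cardfsUI.
rewrite (_ : (A `\` B) `&` (B `\` A) = fset0) ?cardfs0 ?addn0//.
by apply/fsetP => x; rewrite !inE; case: (x \in A); case: (x \in B).
Qed.

(** Translating the argument by g amounts to averaging over the left translate
    of A; for a Folner sequence this changes the average by o(1). *)
Lemma avg_translate A f g C : A != fset0 -> (forall g, `|f g| <= C) ->
  let gA := [fset (g * h)%g | h in A] in
  `|avg A (fun h => f (g * h)%g) - avg A f| <=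
    C * (#|` (A `\` gA) `|` (gA `\` A)|%:R / #|` A|%:R).
Proof.
move=> A0 fC /=; set gA := [fset (g * h)%g | h in A].
have -> : avg A (fun h => f (g * h)%g) = (\sum_(h <- gA) f h) / #|` A|%:R.
  by rewrite /avg big_imfset//= => x y _ _; exact: mulgI.
rewrite /avg -mulrBl normrM mulrA [X in _ * X]ger0_norm ?invr_ge0//.
by rewrite ler_wpM2r ?invr_ge0// fsetUC; exact: sum_fsetB_le.
Qed.

End folner_averages.

Section invariant_means.
Context {R : realType} {G : groupType}.

(** A mean is carried by a total function on G -> R; its laws are only imposed
    on bounded functions, outside of which limits along an ultrafilter are
    arbitrary. *)
Record invariant_mean (L : (G -> R) -> R) : Prop := InvariantMean {
  meanD : forall f h, bdd f -> bdd h -> L (fun g => f g + h g) = L f + L h;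
  meanZ : forall c f, bdd f -> L (fun g => c * f g) = c * L f;
  mean_le : forall f h, bdd f -> bdd h -> (forall g, f g <= h g) -> L f <= L h;
  mean_cst : forall c, L (fun=> c) = c;
  mean_translate : forall g f, bdd f -> L (fun h => f (g * h)%g) = L f }.

Lemma bdd_avg (F : nat -> {fset G}) (f : G -> R) :
  (forall n, F n != fset0%fset) -> bdd f ->
  bdd (fun n => avg (F n) f).
Proof. by move=> F0 [C fC]; exists C => n; exact: avg_norm_le. Qed.

Lemma folner_mean (F : nat -> {fset G}) (W : set_system nat) : is_folner R F ->
  UltraFilter W -> \oo `<=` W ->
  invariant_mean (fun f => lim ((fun n => avg (F n) f) @ W) : R).
Proof.
move=> [F0 Finv] UW ooW.
split=> [f h bf bh|c f bf|f h bf bh fh|c|g f bf].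
- under eq_fun do rewrite avgD.
  by rewrite ultra_limD//; exact: bdd_avg.
- under eq_fun do rewrite avgZ.
  by rewrite ultra_limZ//; exact: bdd_avg.
- apply: ultra_lim_le; [exact: bdd_avg|exact: bdd_avg|].
  by apply: filterE => n; exact: avg_le.
- under eq_fun do rewrite avg_cst//.
  exact: ultra_lim_cst.
- have [C fC] := bf.
  have bgf : bdd (fun h => f (g * h)%g) by exists C.
  apply/eqP; rewrite -subr_eq0 -mulN1r -ultra_limZ; last exact: bdd_avg.
  rewrite -ultra_limD; [|exact: bdd_avg|exact/bddZ/bdd_avg].
  under eq_fun do rewrite mulN1r.
  apply/eqP; apply/cvg_lim => //; apply: (cvg_trans (cvg_app _ ooW)).
  apply/norm_cvg0P.
  apply: squeeze_cvgr; last 2 first.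
  + exact: cvg_cst.
  + rewrite -[X in _ --> X](mulr0 C); apply: cvgM; first exact: cvg_cst.
    exact: Finv.
  + by apply: nearW => n; rewrite normr_ge0/=; exact: avg_translate (F0 n) fC.
Qed.

End invariant_means.

(** * The Weyl pseudometric through invariant means *)

Section weyl_means.
Context {R : realType} {G : groupType}.

(** If the limsup exceeds c then u exceeds c at arbitrarily large indices, so
    the set of these indices generates, together with the neighbourhoods of
    infinity, a proper filter, which extends to an ultrafilter. *)
Lemma limn_esup_gt_ultra (u : nat -> R) c : (c%:E < limn_esup (EFin \o u))%E ->
  exists W, [/\ UltraFilter W, \oo `<=` W & W [set n | c < u n]].
Proof.
move=> cu.
(* Neighbourhoods of infinity meet [set n | c < u n]. *)
have PS : ProperFilter (within [set n | c < u n] \oo).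
  apply: Build_ProperFilter_ex => A /= wA.
  have : (c%:E < ereal_sup ((EFin \o u) @` [set n | (c < u n)%R -> A n]))%E.
    by apply: (lt_le_trans cu); apply: ereal_inf_lbound; exists [set n | c < u n -> A n].
  move=> /ereal_sup_gt[_ [n /= cA <-]]; rewrite lte_fin => cun.
  by exists n; exact: cA.
have [W [UW sW]] := ultraFilterLemma PS.
exists W; split=> //.
- by move=> A ooA; apply: sW; rewrite /within/=; apply: filterS ooA => n An _.
- by apply: sW; rewrite /within/=; exact: filterE.
Qed.

Lemma ultra_lim_le_limn_esup (W : set_system nat) (u : nat -> R) :
  UltraFilter W -> \oo `<=` W -> bdd u ->
  ((lim (u @ W))%:E <= limn_esup (EFin \o u))%E.
Proof.
move=> UW ooW bu; apply: le_ereal_inf_tmp => _ [A /ooW WA <-].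
have uA n : A n -> ((u n)%:E <= ereal_sup ((EFin \o u) @` A))%E.
  by move=> An; apply: ereal_sup_ubound; exists n.
case: (ereal_sup _) uA => [s| |] uA; first last.
- have [n An] := filter_ex WA.
  by have := uA n An; rewrite leNgt ltNyr.
- exact: leey.
- rewrite lee_fin -(ultra_lim_cst (W := W) s); apply: ultra_lim_le => //.
    exact: bdd_cst.
  by apply: filterS WA => n /uA; rewrite lee_fin.
Qed.

Lemma compact_mdist_le (X : metricType R) : compact [set: X] ->
  exists2 C : R, 0 < C & forall p q : X, mdist p q <= C.
Proof.
move=> cX; have [[x0]|noX] := pselect (inhabited X); last first.
  by exists 1 => // p; exfalso; exact/noX/inhabits.
have /compact_near_coveringP/(_ nat \oo (fun n x => mdist x0 x < n%:R)) := cX.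
have nearX (x : X) : [set: X] x ->
    \forall x' \near x & n \near \oo, mdist x0 x' < n%:R.
  move=> _.
  exists (ball x 1, [set n | mdist x0 x + 1 < n%:R]) => /=.
    split; first exact: nbhsx_ballx.
    exact: nbhs_infty_gtr.
  move=> [y n] [/=]; rewrite ballEmdist/= => xy xn.
  by rewrite (le_lt_trans (metric_triangle x0 x y))// (le_lt_trans _ xn)// lerD2l ltW.
move=> /(_ _ nearX)[N _ NX]; exists (N%:R + N%:R + 1) => [|p q].
  by rewrite ltr_wpDl// addr_ge0.
rewrite (le_trans (metric_triangle p x0 q))// metric_sym.
have := NX N (leqnn _) p I; have := NX N (leqnn _) q I; rewrite /=; lra.
Qed.

Lemma bdd_mdist (X : metricType R) I (u v : I -> X) :
  compact [set: X] -> bdd (fun i => mdist (u i) (v i)).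
Proof.
move=> /compact_mdist_le[C _ XC]; exists C => i.
by rewrite ger0_norm ?mdist_ge0.
Qed.

(** Some Folner sequence makes the limsup in the Weyl pseudometric of (x, x')
    exceed c, and the limit of averages along a suitable ultrafilter keeps this
    bound. The same mean bounds the Weyl pseudometric of every other action from
    below, since an ultralimit is at most the limsup and the Weyl pseudometric
    is a supremum over all Folner sequences. *)
Lemma weyl_mean (X : metricType R) (a : action G X) x x' c :
  compact [set: X] -> (c%:E < weyl a x x')%E ->
  exists L : (G -> R) -> R, [/\ invariant_mean L,
    c <= L (fun g => mdist (a g x) (a g x')) &
    forall (Y : metricType R) (b : action G Y) y y', compact [set: Y] ->
      ((L (fun g => mdist (b g y) (b g y')))%:E <= weyl b y y')%E].
Proof.
move=> cX /ereal_sup_gt[_ [F FF <-]] cF.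
have [F0 _] := FF.
have [W [UW ooW cW]] := limn_esup_gt_ultra cF.
exists (fun f => lim ((fun n => avg (F n) f) @ W)); split.
- exact: folner_mean.
- rewrite -(ultra_lim_cst (W := W) c); apply: ultra_lim_le.
  + exact: bdd_cst.
  + exact/bdd_avg/bdd_mdist.
  + by apply: filterS cW => n /ltW.
- move=> Y b y y' cY; apply: (@le_trans _ _ (limn_esup
    (EFin \o (fun n => avg (F n) (fun g => mdist (b g y) (b g y')))))).
    apply: ultra_lim_le_limn_esup => //.
    exact/bdd_avg/bdd_mdist.
  by apply: ereal_sup_ubound; exists F.
Qed.

Lemma weyl_ge0 (X : metricType R) (a : action G X) x x' :
  amenable R G -> (0 <= weyl a x x')%E.
Proof.
move=> [F FF]; apply: (@le_trans _ _ (limn_esup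
    (EFin \o (fun n => avg (F n) (fun g => mdist (a g x) (a g x')))))); last first.
  by apply: ereal_sup_ubound; exists F.
apply: limf_esup_ge0 => [|n]; first exact: filter_not_empty.
by rewrite lee_fin divr_ge0// sumr_ge0// => g _; exact: mdist_ge0.
Qed.

End weyl_means.

(** * Finitely additive probabilities and their regularization *)

Section finitely_additive.
Context {R : realType} {X : Type}.
Implicit Types A B : set X.

Record fin_additive_probability (m : set X -> R) : Prop :=
  FinAdditiveProbability {
    fap_ge0 : forall A, 0 <= m A;
    fapT : m setT = 1;
    fapU : forall A B, A `&` B = set0 -> m (A `|` B) = m A + m B }.

Context (m : set X -> R) (pm : fin_additive_probability m).

Lemma le_fap A B : A `<=` B -> m A <= m B.
Proof.
move=> AB; have -> : B = A `|` (B `\` A) by rewrite setDUK.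
by rewrite (fapU pm) ?setDIK// lerDl (fap_ge0 pm).
Qed.

Lemma fap0 : m set0 = 0.
Proof. by have := fapU pm (setI0 set0); rewrite setU0; lra. Qed.

Lemma fapU_le A B : m (A `|` B) <= m A + m B.
Proof.
rewrite -(setDUK (@subsetUl _ A B)) (fapU pm) ?setDIK// lerD2l le_fap//.
by move=> x [[]].
Qed.

End finitely_additive.

Section regularization.
Context {R : realType} {X : topologicalType} (m : set X -> R).
Hypothesis pm : fin_additive_probability m.
Hypothesis compactX : compact [set: X].
Hypothesis hausX : hausdorff_space X.
Implicit Types A B U V K : set X.
Local Open Scope ereal_scope.

(** The mass of an open set is taken from inside through closed sets: m itself
    need not be countably subadditive on open sets, while this inner mass is,
    because closed sets are compact. *)
Definition inner_content U : \bar R :=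
  ereal_sup [set (m K)%:E | K in [set K | closed K /\ K `<=` U]].

Definition regular_outer A : \bar R :=
  ereal_inf [set inner_content U | U in [set U | open U /\ A `<=` U]].

Lemma inner_content_ge U K : closed K -> K `<=` U -> (m K)%:E <= inner_content U.
Proof. by move=> cK KU; apply: ereal_sup_ubound; exists K. Qed.

Lemma inner_content_ge0 U : 0 <= inner_content U.
Proof.
have <- : (m set0)%:E = 0 by rewrite (fap0 pm).
by apply: inner_content_ge => //; exact: closed0.
Qed.

Lemma le_inner_content U V : U `<=` V -> inner_content U <= inner_content V.
Proof.
move=> UV; apply: ereal_sup_le => _ [K [cK KU] <-].
by exists K => //; split=> //; exact: subset_trans UV.
Qed.

Lemma inner_content0 : inner_content set0 = 0.
Proof.
apply/eqP; rewrite eq_le inner_content_ge0 andbT.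
by apply: ge_ereal_sup => _ [K [_ +] <-]; rewrite subset0 => ->; rewrite (fap0 pm).
Qed.

Lemma inner_contentT : inner_content setT = 1.
Proof.
apply/eqP; rewrite eq_le; apply/andP; split.
  by apply: ge_ereal_sup => _ [K [_ KT] <-]; rewrite lee_fin -(fapT pm) le_fap.
have <- : (m setT)%:E = 1 by rewrite (fapT pm).
by apply: inner_content_ge => //; exact: closedT.
Qed.

(** By normality a closed subset of U `|` V is the union of a closed subset of
    U and a closed subset of V. *)
Lemma inner_contentU U V : open U -> open V ->
  inner_content (U `|` V) <= inner_content U + inner_content V.
Proof.
move=> oU oV; apply: ge_ereal_sup => _ [K [cK KUV] <-].
have closedD W : open W -> closed (K `\` W).
  by move=> oW; rewrite setDE; apply: closedI => //; exact: open_closedC.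
have := (normal_openP (R := R)).1 (compact_normal hausX compactX).
move=> /(_ (K `\` U) (K `\` V)) [||| P [Q [oP oQ KP KQ PQ]]].
- exact: closedD.
- exact: closedD.
- rewrite -subset0 => x [[Kx nUx] [_ nVx]].
  by have [] := KUV x Kx.
have KE : K `<=` (K `\` P) `|` (K `\` Q).
  move=> x Kx; have [Px|nPx] := pselect (P x); last by left.
  right; split=> // Qx.
  by have : (P `&` Q) x by []; rewrite PQ.
apply: (@le_trans _ _ ((m (K `\` P))%:E + (m (K `\` Q))%:E)).
  by rewrite -EFinD lee_fin (le_trans (le_fap pm KE))// fapU_le.
apply: leeD; apply: inner_content_ge.
- exact: closedD.
- by move=> x [Kx nPx]; apply: contrapT => nUx; apply/nPx/KP.
- exact: closedD.
- by move=> x [Kx nQx]; apply: contrapT => nVx; apply/nQx/KQ.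
Qed.

(** A closed subset of the union is compact, hence covered by finitely many of
    the open sets, for which finite subadditivity applies. *)
Lemma inner_content_bigcup (U : (set X)^nat) : (forall n, open (U n)) ->
  inner_content (\bigcup_n U n) <= \sum_(n <oo) inner_content (U n).
Proof.
move=> oU.
have finU n : inner_content (\big[setU/set0]_(i < n) U i)
    <= \sum_(i < n) inner_content (U i).
  elim: n => [|n ih]; first by rewrite !big_ord0 inner_content0.
  have oB : open (\big[setU/set0]_(i < n) U i).
    by rewrite -bigcup_mkord; apply: bigcup_open => i _; exact: oU.
  rewrite !big_ord_recr/= (le_trans (inner_contentU oB (oU n)))//.
  by rewrite leeD2r.
apply: ge_ereal_sup => _ [K [cK KU] <-].
have cptK : compact K by exact: subclosed_compact cK compactX _.
move/compact_near_coveringP/(_ nat \oo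
  (fun n => \big[setU/set0]_(i < n) U i)) : cptK => cptK.
have [x Kx|N _ /(_ N (leqnn _)) KN] := cptK _ _.
  have [i _ Uix] := KU x Kx.
  exists (U i, [set n | (i < n)%N]) => /=.
    by split; [exact: open_nbhs_nbhs|exists i.+1].
  move=> [y n] [/= Uiy ltin].
  by rewrite -bigcup_mkord; exists i.
apply: (@le_trans _ _ (\sum_(i < N) inner_content (U i))).
  exact: le_trans (inner_content_ge cK KN) (finU N).
rewrite -(big_mkord xpredT (fun i => inner_content (U i))).
apply: nneseries_lim_ge => n _ _; exact: inner_content_ge0.
Qed.

Lemma regular_outer_open U : open U -> regular_outer U = inner_content U.
Proof.
move=> oU; apply/eqP; rewrite eq_le; apply/andP; split.
  by apply: ereal_inf_lbound; exists U => //; split.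
by apply: le_ereal_inf_tmp => _ [V [oV UV] <-]; exact: le_inner_content.
Qed.

Lemma le_regular_outer A B : A `<=` B -> regular_outer A <= regular_outer B.
Proof.
move=> AB; apply: ereal_inf_le_tmp => _ [U [oU BU] <-].
by exists U => //; split=> //; exact: subset_trans BU.
Qed.

Lemma regular_outer_ge0 A : 0 <= regular_outer A.
Proof. by apply: le_ereal_inf_tmp => _ [U _ <-]; exact: inner_content_ge0. Qed.

Lemma regular_outer0 : regular_outer set0 = 0.
Proof. by rewrite regular_outer_open ?inner_content0//; exact: open0. Qed.

Lemma regular_outerT : regular_outer setT = 1.
Proof. by rewrite regular_outer_open ?inner_contentT//; exact: openT. Qed.

Lemma regular_outer_fin A : regular_outer A \is a fin_num.
Proof.
apply/fin_numPlt; rewrite (lt_le_trans _ (regular_outer_ge0 A)) ?ltNyr//=.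
by rewrite (le_lt_trans (le_regular_outer (@subsetT _ A)))// regular_outerT ltry.
Qed.

Lemma regular_outer_lt A e : regular_outer A < e ->
  exists2 U, open U /\ A `<=` U & inner_content U < e.
Proof. by move=> /ereal_inf_lt[_ [U [oU AU] <-]]; exists U. Qed.

Lemma regular_outer_sigma_subadditive : sigma_subadditive regular_outer.
Proof.
move=> A; apply/lee_addgt0Pr => e e0.
apply: le_trans (epsilon_trick xpredT
  (fun n => regular_outer_ge0 (A n)) (ltW e0)).
have /choice[U PU] n : exists U, [/\ open U, A n `<=` U &
    inner_content U <= regular_outer (A n) + (e / (2 ^ n.+1)%:R)%:E].
  have [U [oU AU] /ltW lU] : exists2 U, open U /\ A n `<=` U & inner_content U <
      regular_outer (A n) + (e / (2 ^ n.+1)%:R)%:E.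
    apply: regular_outer_lt; rewrite lteDl ?regular_outer_fin// lte_fin.
    by rewrite divr_gt0// ltr0n expn_gt0.
  by exists U.
apply: (@le_trans _ _ (inner_content (\bigcup_n U n))).
  apply: ereal_inf_lbound; exists (\bigcup_n U n) => //; split.
    by apply: bigcup_open => n _; have [] := PU n.
  by apply: subset_bigcup => n _; have [] := PU n.
apply: (le_trans (inner_content_bigcup _)); first by move=> n; have [] := PU n.
apply: lee_nneseries => n _; first by move=> _; exact: inner_content_ge0.
by have [] := PU n.
Qed.

(** It suffices to split an open V containing the test set. Take K closed in
    V `&` U almost exhausting its mass, then L closed in V `\` K almost
    exhausting its mass; K and L are disjoint, so m is additive on them, and
    their union is a closed subset of V. *)
Lemma regular_outer_caratheodory_open (mu : {outer_measure set X -> \bar R}) U :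
  (mu : set X -> \bar R) = regular_outer -> open U -> mu.-caratheodory U.
Proof.
move=> muE oU; apply: le_caratheodory_measurable => A; rewrite muE.
apply: le_ereal_inf_tmp => _ [V [oV AV] <-].
apply: (@le_trans _ _ (inner_content (V `&` U) + regular_outer (V `\` U))).
  apply: leeD.
    rewrite -regular_outer_open; last exact: openI.
    by apply: le_regular_outer; exact: setSI.
  by apply: le_regular_outer; exact: setSI.
rewrite -leeBrDr ?regular_outer_fin//.
apply: ge_ereal_sup => _ [K [cK KVU] <-].
rewrite leeBrDr ?regular_outer_fin//.
apply: (@le_trans _ _ ((m K)%:E + inner_content (V `\` K))).
  rewrite leeD2l//.
  rewrite -regular_outer_open; last by rewrite setDE; apply: openI => //; exact: closed_openC.
  by apply: le_regular_outer => x [Vx nUx]; split=> // /KVU[].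
rewrite addeC -leeBrDr//.
apply: ge_ereal_sup => _ [L [cL LVK] <-].
rewrite leeBrDr// -EFinD -(fapU pm); last first.
  by rewrite -subset0 => x [/LVK[]].
apply: inner_content_ge; first exact: closedU.
by move=> x [/LVK[]|/KVU[]].
Qed.

End regularization.

Section regular_measure.
Context {R : realType} {X : topologicalType} (m : set X -> R).
Hypothesis pm : fin_additive_probability m.
Hypothesis compactX : compact [set: X].
Hypothesis hausX : hausdorff_space X.
Local Open Scope ereal_scope.

(** Open sets are Caratheodory measurable for the regular outer measure, hence
    so are Borel sets. *)
Lemma regular_probability (x0 : X) : exists mu : probability (borel x0) R,
  forall A, mu A = regular_outer m A.
Proof.
pose T := pointed_at x0.
pose nu0 : set T -> \bar R := regular_outer m.
pose nuM := @isOuterMeasure.Build R T nu0 (regular_outer0 pm)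
  (regular_outer_ge0 pm) (@le_regular_outer _ _ m)
  (regular_outer_sigma_subadditive pm compactX hausX).
pose nu : {outer_measure set T -> \bar R} := HB.pack nu0 nuM.
have cara (A : set (borel x0)) : measurable A -> nu.-caratheodory A.
  move: A; apply: smallest_sub.
    split.
    - exact: caratheodory_measurable_set0.
    - by move=> A mA; rewrite setTD; exact: caratheodory_measurable_setC.
    - by move=> A mA; exact: caratheodory_measurable_bigcup.
  by move=> U oU; exact: (regular_outer_caratheodory_open pm).
pose mu0 : set (borel x0) -> \bar R := regular_outer m.
have mu0_sigma : semi_sigma_additive mu0.
  move=> A mA tA mUA.
  apply: (@caratheodory_measure_sigma_additive R T nu A) => //.
  - by move=> i; exact: cara.
  - exact: cara.
pose mu1 := @isMeasure.Build _ (borel x0) R mu0 (regular_outer0 pm)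
  (regular_outer_ge0 pm) mu0_sigma.
pose mu2 : {measure set (borel x0) -> \bar R} := HB.pack mu0 mu1.
pose mu3 := Measure_isProbability.Build _ (borel x0) R mu2 (regular_outerT pm).
pose mu : probability (borel x0) R := HB.pack (Measure.sort mu2) mu3.
by exists mu.
Qed.

Lemma regular_outer_homeo (f f' : X -> X) :
  continuous f -> continuous f' -> cancel f f' -> cancel f' f ->
  (forall A, m (f @^-1` A) = m A) ->
  forall A, regular_outer m (f @^-1` A) = regular_outer m A.
Proof.
have le (h h' : X -> X) : continuous h -> continuous h' -> cancel h h' ->
    cancel h' h -> (forall A, m (h @^-1` A) = m A) ->
    forall A, regular_outer m (h @^-1` A) <= regular_outer m A.
  move=> ch ch' hK h'K mh A; apply: le_ereal_inf_tmp => _ [U [oU AU] <-].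
  apply: (@le_trans _ _ (inner_content m (h @^-1` U))).
    apply: ereal_inf_lbound; exists (h @^-1` U) => //; split.
      by apply: open_comp => // x _; exact: ch.
    by move=> x /=; exact: AU.
  apply: ge_ereal_sup => _ [K [cK KU] <-].
  rewrite -[K](_ : h @^-1` (h' @^-1` K) = K); last first.
    by apply/seteqP; split=> x /=; rewrite hK.
  rewrite mh; apply: inner_content_ge.
    by apply: preimage_closed => // x; exact: ch'.
  by move=> x /= /KU; rewrite /= h'K.
move=> cf cf' fK f'K mf A; apply/eqP; rewrite eq_le (le _ f')//=.
rewrite -[A in leLHS](_ : f' @^-1` (f @^-1` A) = A); last first.
  by apply/seteqP; split=> x /=; rewrite f'K.
apply: (le _ f) => // B; rewrite -[in LHS]mf; congr m.
by apply/seteqP; split=> x /=; rewrite fK.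
Qed.

End regular_measure.

(** * Compactness arguments in metric spaces *)

Section metric_compactness.
Context {R : realType}.

Lemma cvg_mdist (P : metricType R) I (W : set_system I) {FW : Filter W}
    (u v : I -> P) (p q : P) :
  u @ W --> p -> v @ W --> q -> (fun i => mdist (u i) (v i)) @ W --> mdist p q.
Proof.
move=> up vq; apply/cvgrPdist_le => e e0.
have e20 : 0 < e / 2 by rewrite divr_gt0.
have nu : \forall i \near W, mdist p (u i) <= e / 2.
  exact: metricType_numDomainType.cvgr_dist_le.
have nv : \forall i \near W, mdist q (v i) <= e / 2.
  exact: metricType_numDomainType.cvgr_dist_le.
apply: filterS2 nu nv => i pu qv.
have := metric_triangle p (u i) q; have := metric_triangle (u i) (v i) q.
have := metric_triangle (u i) p (v i); have := metric_triangle p q (v i).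
rewrite ler_norml (metric_sym (u i) p) (metric_sym (v i) q); lra.
Qed.

Lemma free_ultrafilter : exists2 W : set_system nat, UltraFilter W & \oo `<=` W.
Proof.
have [W [UW ooW]] := ultraFilterLemma (eventually_filter : ProperFilter \oo).
by exists W.
Qed.

Lemma harmonic_ultra (W : set_system nat) : \oo `<=` W ->
  (fun n => n.+1%:R^-1 : R) @ W --> (0 : R).
Proof. by move=> ooW; apply: cvg_trans (cvg_app _ ooW) cvg_harmonic. Qed.

(** Otherwise there are pairs (a_n, b_n) converging to K whose images under h
    are asymptotically equal while those under f stay e-apart; their limits
    along an ultrafilter lie in K and contradict the hypothesis. For K = setT
    and h = id this is uniform continuity of f; for f = id it is continuity of
    the inverse of h restricted to K, on a neighbourhood of K. *)
Lemma factor_modulus (X P Q : metricType R) (f : X -> P) (h : X -> Q)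
    (K : set X) (e : R) :
  compact [set: X] -> continuous f -> continuous h -> closed K ->
  (forall a b, K a -> K b -> h a = h b -> f a = f b) -> 0 < e ->
  exists2 d, 0 < d & exists2 V, open V /\ K `<=` V &
    forall a b, V a -> V b -> mdist (h a) (h b) < d -> mdist (f a) (f b) < e.
Proof.
move=> cX cf ch cK inj e0; apply: contrapT => nE.
pose V (d : R) := \bigcup_(k in K) (ball k d)°.
have /choice[s sP] n : exists s : (X * X) * (X * X), [/\ K s.1.2 /\ K s.2.2,
    mdist s.1.2 s.1.1 < n.+1%:R^-1, mdist s.2.2 s.2.1 < n.+1%:R^-1,
    mdist (h s.1.1) (h s.2.1) < n.+1%:R^-1 & e <= mdist (f s.1.1) (f s.2.1)].
  apply: contrapT => ns; apply: nE; exists n.+1%:R^-1; first by rewrite invr_gt0.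
  exists (V n.+1%:R^-1).
    split; first by apply: bigcup_open => k _; exact: open_interior.
    by move=> k Kk; exists k => //; apply: nbhsx_ballx; rewrite invr_gt0.
  move=> a b [k Kk /interior_subset ka] [l Kl /interior_subset lb] hab; rewrite ltNge; apply/negP => fab.
  by apply: ns; exists ((a, k), (b, l)); rewrite !ballEmdist in ka lb; split.
have [W UW ooW] := free_ultrafilter.
have cptK : compact K by exact: subclosed_compact cK cX _.
have [a _ ua] := ultra_compact_cvg (u := fun n => (s n).1.1) cX (fun=> I).
have [b _ ub] := ultra_compact_cvg (u := fun n => (s n).2.1) cX (fun=> I).
have [k Kk uk] : exists2 k, K k & (fun n => (s n).1.2) @ W --> k.
  by apply: ultra_compact_cvg cptK _ => n; have [[]] := sP n.
have [l Kl ul] : exists2 l, K l & (fun n => (s n).2.2) @ W --> l.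
  by apply: ultra_compact_cvg cptK _ => n; have [[]] := sP n.
have lim_eq (T : metricType R) (u v : nat -> T) (p q : T) : u @ W --> p ->
    v @ W --> q -> (forall n, mdist (u n) (v n) < n.+1%:R^-1) -> p = q.
  move=> up vq uv; apply: (@mdist_positivity R T); apply/eqP; rewrite eq_le mdist_ge0 andbT.
  apply: ler_cvg_to (cvg_mdist up vq) (harmonic_ultra ooW) _.
  by apply: filterE => n; exact/ltW.
have ka : k = a by apply: lim_eq uk ua _ => n; have [] := sP n.
have lb : l = b by apply: lim_eq ul ub _ => n; have [] := sP n.
have hua : (fun n => h (s n).1.1) @ W --> h a by apply: cvg_comp ua _; exact: ch.
have hub : (fun n => h (s n).2.1) @ W --> h b by apply: cvg_comp ub _; exact: ch.
have fua : (fun n => f (s n).1.1) @ W --> f a by apply: cvg_comp ua _; exact: cf.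
have fub : (fun n => f (s n).2.1) @ W --> f b by apply: cvg_comp ub _; exact: cf.
have hab : h a = h b by apply: lim_eq hua hub _ => n; have [] := sP n.
have fab : f a = f b by apply: inj; rewrite -?ka -?lb// ka lb.
suff : e <= mdist (f a) (f b) by rewrite fab mdistxx leNgt e0.
apply: ler_cvg_to (cvg_cst e) (cvg_mdist fua fub) _.
by apply: filterE => n; have [] := sP n.
Qed.

End metric_compactness.

(** * Finitely additive probabilities from means *)

Section means_and_measures.
Context {R : realType}.
Implicit Types X : Type.

Lemma fap_bdd X (m : nat -> set X -> R) A :
  (forall n, fin_additive_probability (m n)) -> bdd (fun n => m n A).
Proof.
move=> pm; apply: (bdd_itv (a := 0) (b := 1)) => n.
by rewrite (fap_ge0 (pm n))/= -(fapT (pm n)) (le_fap (pm n)).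
Qed.

(** Finite additivity, unlike countable additivity, survives pointwise limits. *)
Lemma ultra_fap X (W : set_system nat) (m : nat -> set X -> R) :
  UltraFilter W -> (forall n, fin_additive_probability (m n)) ->
  fin_additive_probability (fun A => lim ((fun n => m n A) @ W) : R).
Proof.
move=> UW pm; split=> [A||A B AB].
- rewrite -(ultra_lim_cst (W := W) 0); apply: ultra_lim_le.
  + exact: bdd_cst.
  + exact: fap_bdd.
  + by apply: filterE => n; exact: fap_ge0 (pm n) A.
- under eq_fun do rewrite fapT//.
  exact: ultra_lim_cst.
- under eq_fun do rewrite fapU//.
  by rewrite ultra_limD//; exact: fap_bdd.
Qed.

Lemma fap_half X (m m' : set X -> R) :
  fin_additive_probability m -> fin_additive_probability m' ->
  fin_additive_probability (fun A => (m A + m' A) / 2).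
Proof.
move=> pm pm'; split=> [A||A B AB].
- by rewrite divr_ge0// addr_ge0// fap_ge0.
- by rewrite !fapT// -[1 + 1]/2 divff.
- by rewrite !fapU//; lra.
Qed.

Context {G : groupType}.

Lemma bdd_indic X (A : set X) I (u : I -> X) : bdd (fun i => \1_A (u i) : R).
Proof.
apply: (bdd_itv (a := 0) (b := 1)) => i.
by rewrite indicE; case: (_ \in _); rewrite lexx ler01.
Qed.

Lemma mean_fap X (L : (G -> R) -> R) (u : G -> X) : invariant_mean L ->
  fin_additive_probability (fun A => L (fun g => \1_A (u g))).
Proof.
move=> mL; split=> [A||A B AB].
- rewrite -(mean_cst mL 0); apply: (mean_le mL); [exact: bdd_cst|exact: bdd_indic|].
  by move=> g; rewrite indicE.
- under eq_fun do rewrite indicT/=.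
  exact: mean_cst.
- rewrite -meanD//; [|exact: bdd_indic|exact: bdd_indic].
  congr L; apply/funext => g; rewrite !indicE in_setU.
  have [Ag|_] := boolP (u g \in A); have [Bg|_] := boolP (u g \in B);
    rewrite /= ?addr0 ?add0r//.
  have : (A `&` B) (u g) by split; exact: set_mem.
  by rewrite AB.
Qed.

End means_and_measures.

(** * Comparison of Weyl pseudometrics *)

Section weyl_comparison.
Context {R : realType} {G : groupType}.

Lemma mean_empirical_invariant (X : topologicalType) (a : action G X)
    (L : (G -> R) -> R) x g A : invariant_mean L ->
  L (fun k => \1_(a g @^-1` A) (a k x)) = L (fun k => \1_A (a k x)).
Proof.
move=> mL; rewrite -(mean_translate mL g (bdd_indic A (fun k => a k x))).
by congr L; apply/funext => k; rewrite !indicE actM.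
Qed.

Lemma invariant_regular_probability (X : topologicalType) (a : action G X)
    (m : set X -> R) (x0 : X) :
  compact [set: X] -> hausdorff_space X -> fin_additive_probability m ->
  (forall g A, m (a g @^-1` A) = m A) ->
  exists2 mu : probability (borel x0) R, invariant_measure a mu &
    forall A, mu A = regular_outer m A.
Proof.
move=> cX hX pm inv; have [mu muE] := regular_probability pm cX hX x0.
exists mu => // g A mA; rewrite /pushforward !muE.
apply: (regular_outer_homeo (f' := a g^-1%g)) => //.
- exact: act_continuous.
- exact: act_continuous.
- by move=> x; rewrite -actM mulVg act1.
- by move=> x; rewrite -actM mulgV act1.
Qed.

(** Up to a null set of each invariant measure, f factors through h. For f = id
    this is injectivity of h almost everywhere. *)
Definition determines (X : topologicalType) (a : action G X) (P Q : Type)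
    (f : X -> P) (h : X -> Q) : Prop :=
  forall (x0 : X) (mu : probability (borel x0) R), invariant_measure a mu ->
  exists B : set (borel x0), [/\ measurable B, mu B = 1%E &
    forall p q, B p -> B q -> h p = h q -> f p = f q].

(** If there were no such d, a limit of the empirical means of worse and worse
    pairs would regularize to an invariant measure. A closed set of almost full
    measure on which h determines f then bounds the proportion of time during
    which the images under f can be apart while those under h are close. *)
Lemma determines_weyl (X P Q : metricType R) (aX : action G X)
    (aP : action G P) (aQ : action G Q) (f : X -> P) (h : X -> Q) (e : R) :
  compact [set: X] -> compact [set: P] -> compact [set: Q] ->
  continuous f -> continuous h ->
  (forall g x, f (aX g x) = aP g (f x)) ->
  (forall g x, h (aX g x) = aQ g (h x)) ->
  determines aX f h -> 0 < e ->
  exists2 d, 0 < d & forall x x',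
    (weyl aQ (h x) (h x') < d%:E)%E -> (weyl aP (f x) (f x') <= e%:E)%E.
Proof.
move=> cX cP cQ cf ch eqf eqh fh e0; apply: contrapT => nE.
have /choice[s sP] n : exists s : X * X * ((G -> R) -> R),
    [/\ invariant_mean s.2,
        e <= s.2 (fun g => mdist (f (aX g s.1.1)) (f (aX g s.1.2))) &
        s.2 (fun g => mdist (h (aX g s.1.1)) (h (aX g s.1.2))) <= n.+1%:R^-1].
  apply: contrapT => ns; apply: nE; exists n.+1%:R^-1; first by rewrite invr_gt0.
  move=> x x' hd; rewrite leNgt; apply/negP => /(weyl_mean cP)[L [mL eL LQ]].
  apply: ns; exists (x, x', L); split => //=.
    by under eq_fun do rewrite !eqf.
  under eq_fun do rewrite !eqh.
  by have /le_lt_trans/(_ hd)/ltW := LQ Q aQ (h x) (h x') cQ; rewrite lee_fin.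
pose L n := (s n).2; pose x n := (s n).1.1; pose x' n := (s n).1.2.
have mL n : invariant_mean (L n) by have [] := sP n.
(* Averaging over both orbits lets one set U control visits of both. *)
pose mn n A := (L n (fun g => \1_A (aX g (x n))) +
                L n (fun g => \1_A (aX g (x' n)))) / 2.
have pmn n : fin_additive_probability (mn n) by apply: fap_half; exact: mean_fap.
have [W UW ooW] := free_ultrafilter.
pose m A : R := lim ((fun n => mn n A) @ W).
have pm : fin_additive_probability m by exact: ultra_fap.
have inv g A : m (aX g @^-1` A) = m A.
  rewrite /m; congr (lim (_ @ W)); apply/funext => n.
  by rewrite /mn !mean_empirical_invariant.
have [mu muinv muE] := invariant_regular_probability (x 0%N) cX
  (@metric_hausdorff _ X) pm inv.
have [B [mB muB injB]] := fh _ _ muinv.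
have [C C0 PC] := compact_mdist_le cP.
(* With m (~` V) < eta, the two orbits spend together a proportion less than
   2 * eta of the time in ~` V, at a cost less than C * (2 * eta) = e / 4. *)
pose eta := e / (8 * C).
have eta0 : 0 < eta by rewrite divr_gt0// mulr_gt0.
have [U [oU BU] innerU] : exists2 U : set X, open U /\ ~` B `<=` U &
    (inner_content m U < eta%:E)%E.
  apply: regular_outer_lt; rewrite -muE.
  by rewrite (probability_setC mu mB) muB subee// lte_fin.
have cK : closed (~` U) by exact: open_closedC.
have KB p : (~` U) p -> B p by move=> nUp; apply: contrapT => /BU.
have e4 : 0 < e / 4 by rewrite divr_gt0.
have [d d0 [V [oV KV] Vd]] := factor_modulus cX cf ch cK
  (fun p q Kp Kq => injB p q (KB p Kp) (KB q Kq)) e4.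
have mV : m (~` V) < eta.
  rewrite -lte_fin; apply: le_lt_trans innerU.
  apply: inner_content_ge; first exact: open_closedC.
  by move=> p nVp; apply: contrapT => /KV.
have nearV : \forall n \near W, mn n (~` V) < eta.
  apply: (@cvgr_lt _ _ W _ (fun n => mn n (~` V))) mV.
  by apply: ultra_lim_cvg; exact: fap_bdd.
have nearh : \forall n \near W, n.+1%:R^-1 < e / 4 * (d / C).
  apply: (@cvgr_lt _ _ W _ (fun n => n.+1%:R^-1 : R)) (harmonic_ultra ooW) _ _.
  by rewrite mulr_gt0// divr_gt0.
have [n [nV nh]] := filter_ex (filterI nearV nearh).
have [_ eL Lh] := sP n.
pose D g := mdist (h (aX g (x n))) (h (aX g (x' n))).
pose I1 g : R := \1_(~` V) (aX g (x n)); pose I2 g : R := \1_(~` V) (aX g (x' n)).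
have bD : bdd D by exact: bdd_mdist.
have b1 : bdd I1 by exact: bdd_indic.
have b2 : bdd I2 by exact: bdd_indic.
(* The three terms dominate, respectively, the times when both points lie in
   V with d-close images under h, the times when one of them is outside V,
   and the times when the images under h are at least d apart. *)
have ptw g : mdist (f (aX g (x n))) (f (aX g (x' n))) <=
    e / 4 + (C * (I1 g + I2 g) + C / d * D g).
  have := PC (f (aX g (x n))) (f (aX g (x' n))).
  rewrite /I1 /I2 !indicE.
  have D0 : 0 <= D g by exact: mdist_ge0.
  have CD0 : 0 <= C / d * D g by rewrite mulr_ge0// divr_ge0// ltW.
  have [V1|V1] := boolP (aX g (x n) \in ~` V).
    by case: (_ \in _); rewrite /=; nra.
  have [V2|V2] := boolP (aX g (x' n) \in ~` V); first by rewrite /=; nra.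
  move: V1 V2; rewrite !in_setC !negbK => /set_mem V1 /set_mem V2.
  have [Dd|dD] := ltP (D g) d; first by have := Vd _ _ V1 V2 Dd; rewrite /=; lra.
  have : C <= C / d * D g by rewrite -mulrA ler_peMr ?(ltW C0)// ler_pdivlMl// mulr1.
  rewrite /=; lra.
have b12 := bddD b1 b2.
have := mean_le (mL n) (bdd_mdist _ _ cP)
  (bddD (bdd_cst (e / 4)) (bddD (bddZ C b12) (bddZ (C / d) bD))) ptw.
rewrite (meanD (mL n) (bdd_cst _) (bddD (bddZ C b12) (bddZ (C / d) bD))).
rewrite (meanD (mL n) (bddZ C b12) (bddZ (C / d) bD)).
rewrite (meanZ (mL n) _ b12) (meanZ (mL n) _ bD) (meanD (mL n) b1 b2).
rewrite (mean_cst (mL n)).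
have LI : C * (L n I1 + L n I2) < e / 4.
  move: nV; rewrite /mn /eta ltr_pdivrMr// => nV.
  rewrite mulrC -ltr_pdivlMr// (lt_le_trans nV)//.
  rewrite le_eqVlt; apply/orP; left; apply/eqP; field.
  by rewrite gt_eqF.
have LD : C / d * L n D < e / 4.
  rewrite mulrC -ltr_pdivlMr ?divr_gt0// invf_div.
  exact: le_lt_trans Lh nh.
rewrite -/(L n) in eL; lra.
Qed.

End weyl_comparison.

(** * Topo-isomorphic factor maps *)

Section topo_isomorphic.
Context {R : realType} {G : groupType}.

Lemma continuous_measurable (X Y : topologicalType) (x0 : X) (phi : X -> Y)
    (M : set (borel (phi x0))) :
  continuous phi -> measurable M -> measurable (phi @^-1` M : set (borel x0)).
Proof.
move=> cphi; move: M; apply: smallest_sub.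
  split=> [|M mM|M mM] /=.
  - by rewrite preimage_set0; exact: measurable0.
  - by rewrite setTD; exact: (measurableC mM).
  - by rewrite preimage_bigcup; exact: bigcup_measurable.
move=> U oU; apply: sub_sigma_algebra.
by apply: open_comp => // x _; exact: cphi.
Qed.

Lemma topo_isomorphic_determines (X Y : topologicalType) (a : action G X)
    (phi : X -> Y) : continuous phi -> topo_isomorphic R a phi ->
  determines (R := R) a id phi.
Proof.
move=> cphi iso x0 mu inv; have [M [mM [_ muM] [_ injM _] _ _]] := iso x0 mu inv.
exists (phi @^-1` M); split=> //; first exact: continuous_measurable.
by move=> p q Mp Mq pq; apply: injM => //; exact: mem_set.
Qed.

Lemma determines_factor (X Y : topologicalType) (a : action G X) (phi : X -> Y) :
  determines (R := R) a phi id.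
Proof.
by move=> x0 mu _; exists setT; split=> // [|p q _ _ ->//]; exact: probability_setT.
Qed.

(** Passage from a modulus between Weyl pseudometrics to asymptotic Banach
    proximality. *)
Lemma cvge_to0 (u v : nat -> \bar R) : (forall n, 0 <= v n)%E ->
  (forall e : R, 0 < e -> exists2 d : R, 0 < d &
     forall n, (u n < d%:E)%E -> (v n <= e%:E)%E) ->
  u @ \oo --> 0%E -> v @ \oo --> 0%E.
Proof.
move=> v0 uv u0; apply: limn_esup_le_cvg => //.
apply/lee_addgt0Pr => e e0; rewrite add0e.
have [d d0 duv] := uv e e0.
have /u0[N _ uN] : nbhs (0%E : \bar R) [set y | (y < d%:E)%E].
  by apply: open_nbhs_nbhs; split; [exact: open_ereal_lt_ereal|rewrite /= lte_fin].
apply: (@le_trans _ _ (ereal_sup (v @` [set n | (N <= n)%N]))).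
  by apply: ereal_inf_lbound; exists [set n | (N <= n)%N] => //; exists N.
by apply: ge_ereal_sup => _ [n Nn <-]; apply: duv; exact: uN.
Qed.

End topo_isomorphic.

Theorem theorem11p1 (R : realType) (G : groupType)
    (countG : countable [set: G]) (amenG : amenable R G)
    (X Y Z : metricType R)
    (compactX : compact [set: X]) (compactY : compact [set: Y])
    (compactZ : compact [set: Z])
    (aX : action G X) (aY : action G Y) (aZ : action G Z)
    (wmeX : weakly_mean_equicontinuous R aX)
    (wmeY : weakly_mean_equicontinuous R aY)
    (wmeZ : weakly_mean_equicontinuous R aZ)
    (phi : X -> Y) (psi : Y -> Z)
    (factor_phi : factor_map aX aY phi) (factor_psi : factor_map aY aZ psi)
    (topo_iso_phi : topo_isomorphic R aX phi)
    (mean_eq_psi : mean_equicontinuous aY psi) :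
  mean_equicontinuous aX (psi \o phi).
Proof.
have [cphi _ eqphi] := factor_phi.
have toY e : 0 < e -> exists2 d, 0 < d & forall x x',
    (weyl aX x x' < d%:E)%E -> (weyl aY (phi x) (phi x') <= e%:E)%E.
  apply: (determines_weyl (h := id) (aQ := aX)) => //; first by move=> x; exact: cvg_id.
  exact: determines_factor.
have toX e : 0 < e -> exists2 d, 0 < d & forall x x',
    (weyl aY (phi x) (phi x') < d%:E)%E -> (weyl aX x x' <= e%:E)%E.
  apply: (determines_weyl (f := id) (aP := aX)) => //; first by move=> x; exact: cvg_id.
  exact: topo_isomorphic_determines.
pose phi2 (p : X * X) := (phi p.1, phi p.2).
have asymP u : asymptotically_banach_proximal aX u <->
    asymptotically_banach_proximal aY (phi2 \o u).
  split; apply: cvge_to0 => [n|e e0].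
  - exact: weyl_ge0.
  - by have [d d0 H] := toY e e0; exists d => // n; exact: H.
  - exact: weyl_ge0.
  - by have [d d0 H] := toX e e0; exists d => // n; exact: H.
have proxP p : banach_proximal aX p.1 p.2 <-> banach_proximal aY (phi p.1) (phi p.2).
  (* Banach proximality of a pair is asymptotic Banach proximality of the
     constant sequence. *)
  have cst0 (P : metricType R) (a : action G P) q : banach_proximal a q.1 q.2 <->
      asymptotically_banach_proximal a (fun=> q).
    split=> [q0|/cvg_lim q0]; first by apply: cvg_trans (cvg_cst _) _; rewrite q0.
    by rewrite /banach_proximal -q0// lim_cst.
  by rewrite (cst0 _ aX p) asymP (cst0 _ aY (phi2 p)).
move=> u p Ru Rp up; rewrite asymP proxP.
apply: (mean_eq_psi (phi2 \o u) (phi2 p)) => //.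
have up1 : (fun n => (u n).1) @ \oo --> p.1 by apply: cvg_comp up _; exact: cvg_fst.
have up2 : (fun n => (u n).2) @ \oo --> p.2 by apply: cvg_comp up _; exact: cvg_snd.
by apply: cvg_pair; [apply: cvg_comp up1 _|apply: cvg_comp up2 _]; exact: cphi.
Qed.
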